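(* Let $N = q^k n^2$ be an odd perfect number written in Eulerian form. Then $q<n$.
   Context: For a positive integer $N$, $\sigma(N)$ denotes the sum of the positive divisors of $N$, and $N$ is perfect when $\sigma(N)=2N$. By Euler, an odd perfect number $N$ can be written as $N=q^k n^2$, where $q$ is a prime (the special prime), $k$ is a positive integer, $q \equiv k \equiv 1 \pmod 4$, $n$ is a positive integer, and $\gcd(q,n)=1$; writing $N$ this way is called writing $N$ in Eulerian form. *)

(* Defs.v *)
From mathcomp Require Import all_boot.

Definition sigma (N : nat) : nat := \sum_(d <- divisors N) d.

Definition perfect (N : nat) : Prop := 0 < N /\ sigma N = 2 * N.

Definition eulerian_form (N q k n : nat) : Prop :=
  [/\ N = q ^ k * n ^ 2,
      prime q,
      0 < k /\ 0 < n,
      q = 1 %[mod 4] /\ k = 1 %[mod 4]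
    & gcdn q n = 1].

(* Main.v *)
(** The case [k >= 5] is easy: [q ^ k] divides [sigma (n ^ 2) < 2 n ^ 2].  So let [k = 1] and
    suppose [n < q].  Some [p ^ a] exactly dividing [n] satisfies [q | sigma (p ^ (2a))], and,
    writing [n = p ^ a m], comparing sizes (after Acquaah and Konyagin) leaves only
      [sigma (p ^ (2a)) = q],  [sigma (m ^ 2) = p ^ (2a)],  [q + 1 = 2 m ^ 2].
    Every prime [r] dividing [m], with exponent [e_r], then satisfies
    [1 + r + ... + r ^ (n_r - 1) = p ^ (j_r)] where [n_r = 2 e_r + 1], so [r ^ n_r] is
    [1 + (r - 1) p] modulo [p ^ 2] if [j_r = 1], and [1] otherwise, whereas
    [2 m ^ 2 = 2 + p + ... + p ^ (2a)] is [2 + p].  Raising [m ^ 2 = prod r ^ (n_r - 1)] to the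
    power [prod n_r] gives, modulo [p],
      [M = 2 sum_{r in T} (r - 1) (n_r - 1) M / n_r],   [M = prod_{r in T} n_r],
    where [T] is the set of [r] with [j_r = 1].  The right side exceeds [M], so it is at least
    [M + p].  But all [r] in [T] represent the same prime [p] as a repunit of prime length
    [n_r] in base [r], and this makes the right side smaller than [M + p]. *)

Require Import Defs.
From Stdlib Require Import NArith.
From mathcomp Require Import all_boot zify.

(** * Repunits and the divisor sum *)

Definition repunit (r n : nat) : nat := \sum_(i < n) r ^ i.

Lemma repunitS r n : repunit r n.+1 = repunit r n + r ^ n.
Proof. by rewrite /repunit big_ord_recr. Qed.

Lemma repunit0 r : repunit r 0 = 0.
Proof. by rewrite /repunit big_ord0. Qed.

Lemma repunitSl r n : repunit r n.+1 = 1 + r * repunit r n.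
Proof.
rewrite /repunit big_ord_recl expn0 big_distrr /=; congr (_ + _).
by apply: eq_bigr => i _; rewrite expnS.
Qed.

Lemma repunit_pred r n : 0 < r -> r.-1 * repunit r n + 1 = r ^ n.
Proof. by move=> r0; rewrite -predn_exp addn1 prednK ?expn_gt0 ?r0. Qed.

Lemma repunitD r a b : repunit r (a + b) = repunit r a + r ^ a * repunit r b.
Proof.
elim: b => [|b IH]; first by rewrite addn0 repunit0 muln0 addn0.
by rewrite addnS !repunitS IH expnD; lia.
Qed.

Lemma repunitM r a b : repunit r (a * b) = repunit r a * repunit (r ^ a) b.
Proof.
elim: b => [|b IH]; first by rewrite muln0 !repunit0 muln0.
by rewrite mulnS addnC repunitD IH repunitS expnM; lia.
Qed.

Lemma coprime_repunit r n : 0 < n -> coprime r (repunit r n).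
Proof. by case: n => // n _; rewrite repunitSl mulnC /coprime addnC gcdnMDl gcdn1. Qed.

Lemma expn_ltn_repunit r n : 1 < r -> 1 < n -> r ^ n.-1 < repunit r n.
Proof.
case: n => [|[|n]] // r1 _; rewrite repunitS /= addnC -[X in X < _]addn0 ltn_add2l.
by rewrite repunitS addn_gt0 expn_gt0 (ltnW r1) orbT.
Qed.

Lemma leq_repunit r s n : r <= s -> repunit r n <= repunit s n.
Proof. by move=> rs; apply: leq_sum => i _; case: (val i) => // k; rewrite leq_exp2r. Qed.

Lemma ltn_repunit r s n : 1 < n -> r < s -> repunit r n < repunit s n.
Proof.
case: n => [|[|n]] // _ rs; rewrite [X in X < _]repunitS [X in _ < X]repunitS -addnS leq_add //.
  by rewrite leq_repunit // ltnW.
by rewrite ltn_exp2r.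
Qed.

Lemma sigmaM a b : 0 < a -> 0 < b -> coprime a b -> sigma (a * b) = sigma a * sigma b.
Proof.
move=> a0 b0 cab; have ab0 : 0 < a * b by rewrite muln_gt0 a0.
have [ua _ ma] := divisors_correct a0; have [ub _ mb] := divisors_correct b0.
have [uab _ mab] := divisors_correct ab0.
pose s := [seq d * e | d <- divisors a, e <- divisors b].
rewrite /sigma (perm_big s) /=; last first.
  apply: uniq_perm => // [|x].
    apply: allpairs_uniq => // -[d e] [d' e'] /allpairsP[[x y] /= [xa yb [-> ->]]].
    move=> /allpairsP[[x' y'] /= [xa' yb' [-> ->]]] /= E.
    rewrite !ma !mb in xa yb xa' yb'.
    (* A divisor [u] of [a] is coprime to a divisor [v'] of [b], so it must divide [u']. Used in
       both directions, this makes the factorisation of a divisor of [a * b] unique. *)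
    have key u v u' v' : u %| a -> v' %| b -> u * v = u' * v' -> u %| u'.
      move=> ua' vb' Ek; rewrite -(@Gauss_dvdl u u' v') ?(coprime_dvdl ua') ?(coprime_dvdr vb') //.
      by rewrite -Ek dvdn_mulr.
    have Ex : x = x' by apply/eqP; rewrite eqn_dvd (key x y x' y') ?(key x' y' x y).
    rewrite -{}Ex in E xa' *; have x0 : 0 < x by apply: dvdn_gt0 xa.
    by move/eqP: E; rewrite eqn_pmul2l // => /eqP->.
  rewrite mab; apply/idP/allpairsP => [xab|[[d e] /= [dA eB ->]]].
    exists (gcdn x a, gcdn x b); rewrite ma mb /= !dvdn_gcdr; split => //.
    apply/eqP; rewrite eqn_dvd; apply/andP; split.
      by rewrite muln_gcdl !muln_gcdr !dvdn_gcd dvdn_mulr // dvdn_mulr // dvdn_mull.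
    rewrite Gauss_dvd ?dvdn_gcdl // (coprime_dvdl (dvdn_gcdr _ _)) //.
    by rewrite (coprime_dvdr (dvdn_gcdr _ _)).
  by rewrite ma in dA; rewrite mb in eB; apply: dvdn_mul.
rewrite /s big_allpairs_dep big_distrl /=; apply: eq_bigr => d _.
by rewrite big_distrr.
Qed.

Lemma sigma_pfactor p e : prime p -> sigma (p ^ e) = repunit p e.+1.
Proof.
move=> pp; have p0 : 0 < p ^ e by rewrite expn_gt0 prime_gt0.
have [u _ mem] := divisors_correct p0.
rewrite /sigma (perm_big [seq p ^ i | i <- iota 0 e.+1]); last first.
  apply: uniq_perm => // [|x].
    rewrite map_inj_uniq ?iota_uniq // => i j /eqP; rewrite eqn_exp2l ?prime_gt1 //.
    by move/eqP.
  rewrite mem; apply/(dvdn_pfactor _ _ pp)/mapP => [[i ie ->]|[i]].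
    by exists i; rewrite // mem_iota.
  by rewrite mem_iota => ie ->; exists i.
by rewrite big_map /repunit -(big_mkord xpredT) /index_iota subn0.
Qed.

Lemma prod_logn n : 0 < n -> n = \prod_(p <- primes n) p ^ logn p n.
Proof.
move=> n0; rewrite {1}(prod_prime_decomp n0) prime_decompE big_map.
by apply: eq_bigr.
Qed.

Lemma coprime_prod_primes (p : nat) (s : seq nat) (e : nat -> nat) :
  prime p -> p \notin s -> all prime s -> coprime p (\prod_(r <- s) r ^ e r).
Proof.
move=> pp; elim: s => [|r s IH] /=; first by rewrite big_nil coprimen1.
rewrite in_cons negb_or => /andP[pr ps] /andP[rp sp].
by rewrite big_cons coprimeMr IH // coprimeXr // prime_coprime // dvdn_prime2.
Qed.

Lemma sigma_prod_primes (s : seq nat) (e : nat -> nat) :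
  uniq s -> all prime s ->
  sigma (\prod_(p <- s) p ^ e p) = \prod_(p <- s) repunit p (e p).+1.
Proof.
elim: s => [|p s IH] /=; first by rewrite !big_nil /sigma big_cons big_nil.
case/andP=> ps us /andP[pp As]; rewrite !big_cons sigmaM.
- by rewrite IH // sigma_pfactor.
- by rewrite expn_gt0 prime_gt0.
- by rewrite big_seq; apply: prodn_cond_gt0 => r /(allP As) /prime_gt0 r0; rewrite expn_gt0 r0.
- by apply: coprimeXl; apply: coprime_prod_primes.
Qed.

Lemma all_prime_primes n : all prime (primes n).
Proof. by apply/allP => p; rewrite mem_primes => /andP[]. Qed.

Lemma sigma_sqr n : 0 < n ->
  sigma (n ^ 2) = \prod_(p <- primes n) repunit p (2 * logn p n).+1.
Proof.
move=> n0; rewrite {1}(prod_logn _ n0).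
have -> (s : seq nat) (e : nat -> nat) :
    (\prod_(p <- s) p ^ e p) ^ 2 = \prod_(p <- s) p ^ (2 * e p).
  rewrite expnS expn1 -big_split /=; apply: eq_bigr => p _.
  by rewrite mul2n -addnn expnD.
by rewrite sigma_prod_primes ?primes_uniq ?all_prime_primes.
Qed.

(** * Numbers that are repunits in two bases *)

(** Horner form over binary numbers, so that [vm_compute] can evaluate repunits of size about
    [2 ^ 60]. *)
Fixpoint repunitN (r : N) (n : nat) : N :=
  if n is n'.+1 then (1 + r * repunitN r n')%num else 0%num.

Lemma repunitNS r n : repunitN r n.+1 = (1 + r * repunitN r n)%num.
Proof. by []. Qed.

Lemma of_natD a b : N.of_nat (a + b) = (N.of_nat a + N.of_nat b)%num.
Proof. exact: Nnat.Nat2N.inj_add. Qed.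

Lemma of_natM a b : N.of_nat (a * b) = (N.of_nat a * N.of_nat b)%num.
Proof. exact: Nnat.Nat2N.inj_mul. Qed.

Lemma repunitNE r n : N.of_nat (repunit r n) = repunitN (N.of_nat r) n.
Proof.
elim: n => [|n IH]; first by rewrite repunit0.
by rewrite repunitSl of_natD of_natM IH.
Qed.

Lemma leq_repunitN a b n : (a <= b)%num -> (repunitN a n <= repunitN b n)%num.
Proof.
move=> ab; elim: n => [|n IH]; first exact: N.le_refl.
by rewrite !repunitNS; apply: N.add_le_mono; [exact: N.le_refl | apply: N.mul_le_mono].
Qed.

(* Bisection for the largest [s] with [repunitN s k <= P]; only the test below, which
   traps [P] strictly between two consecutive repunits of length [k], is trusted. *)
Fixpoint repunit_root (fuel : nat) (P : N) (k : nat) (lo hi : N) : N :=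
  if fuel is f.+1 then
    let mid := N.div2 (lo + hi) in
    if (repunitN mid k <=? P)%num then repunit_root f P k mid hi
    else repunit_root f P k lo mid
  else lo.

(** When [P < 2 ^ 60] and [k >= 5], the root satisfies [s ^ 4 < 2 ^ 60], so it lies below
    [32768 = 2 ^ 15] and sixteen halvings isolate it. *)
Definition not_repunit (P : N) (k : nat) : bool :=
  let s := repunit_root 16 P k 0%num 32768%num in
  ((repunitN s k <? P) && (P <? repunitN (s + 1) k))%num.

Lemma not_repunitP P k s : not_repunit P k -> repunitN s k <> P.
Proof.
rewrite /not_repunit; set t := repunit_root _ _ _ _ _; case/andP=> /N.ltb_lt l1 /N.ltb_lt l2 E.
have [le|lt] := N.le_gt_cases s t.
  by have := leq_repunitN s t k le; rewrite E; lia.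
have le : (t + 1 <= s)%num by lia.
by have := leq_repunitN _ s k le; rewrite E; lia.
Qed.

(** For odd [n] the list runs over the odd [k] from 5 to [n - 2]; values from [2 ^ 60] on pass
    untested. *)
Definition no_double_repunit_at (n r : nat) : bool :=
  let P := repunitN (N.of_nat r) n in
  if (2 ^ 60 <=? P)%num then true else
    all (not_repunit P) [seq 2 * i + 5 | i <- iota 0 (n - 5)./2].

Lemma no_double_repunit_atT n r : 6 < n < 39 -> odd n -> 2 < r < 1024 -> no_double_repunit_at n r.
Proof.
have /allP H : all (fun n => all (no_double_repunit_at n) (iota 3 1021))
    [seq 2 * i + 7 | i <- iota 0 16].
  by vm_compute.
move=> n6 no r2; have /H/allP : n \in [seq 2 * i + 7 | i <- iota 0 16].
  by apply/mapP; exists ((n - 7)./2); rewrite ?mem_iota; lia.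
by apply; rewrite mem_iota; lia.
Qed.

Lemma leq_of_N a b : (N.of_nat a <=? N.of_nat b)%num -> a <= b.
Proof. by move/N.leb_le; lia. Qed.

Lemma of_nat_expn a b : N.of_nat (a ^ b) = (N.of_nat a ^ N.of_nat b)%num.
Proof.
elim: b => [|b IH] //.
by rewrite expnS of_natM IH Nnat.Nat2N.inj_succ N.pow_succ_r'.
Qed.

(* The bound [2 ^ 60] is only ever handled in binary. *)
Lemma double_repunit_large B r s n k : N.of_nat B = (2 ^ 60)%num ->
  2 < r -> odd n -> odd k -> 4 < k -> k < n ->
  repunit r n = repunit s k -> B <= repunit r n.
Proof.
move=> EB r2 no ko k4 kn E; rewrite leqNgt; apply/negP => lt.
have n1 : 1 < n by lia.
have r1 : 1 < r by lia.
have rn := ltn_trans (expn_ltn_repunit r n r1 n1) lt.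
(* Outside [n < 39] and [r < 1024] the bound is reached anyway: [3 ^ 38 > 2 ^ 60], and
   [1024 ^ 6 = 2 ^ 60] where [n >= 7] by parity. *)
have n39 : n < 39.
  rewrite ltnNge; apply/negP => nn.
  have le : 3 ^ 38 <= r ^ n.-1.
    by apply: (@leq_trans (r ^ 38)); [rewrite leq_exp2r | rewrite leq_exp2l]; lia.
  have : B <= 3 ^ 38 by apply: leq_of_N; rewrite EB of_nat_expn; vm_compute.
  by move/leq_trans/(_ le); rewrite leqNgt rn.
have r1024 : r < 1024.
  rewrite ltnNge; apply/negP => rr.
  have le : 1024 ^ 6 <= r ^ n.-1.
    by apply: (@leq_trans (r ^ 6)); [rewrite leq_exp2r | rewrite leq_exp2l]; lia.
  have : B <= 1024 ^ 6 by apply: leq_of_N; rewrite EB of_nat_expn; vm_compute.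
  by move/leq_trans/(_ le); rewrite leqNgt rn.
have : no_double_repunit_at n r by apply: no_double_repunit_atT; lia.
rewrite /no_double_repunit_at; case: ifP => [H1 _|_ /allP/(_ k) H1].
  have : B <= repunit r n by apply: leq_of_N; rewrite EB repunitNE.
  by rewrite leqNgt lt.
have {}H1 : not_repunit (repunitN (N.of_nat r) n) k.
  by apply: H1; apply/mapP; exists ((k - 5)./2); rewrite ?mem_iota; lia.
by apply: (not_repunitP _ _ (N.of_nat s) H1); rewrite -!repunitNE E.
Qed.

(** * Products of primes *)

Lemma prod_primes_dvdn (s : seq nat) x : uniq s -> all prime s ->
  {in s, forall l, l %| x} -> \prod_(l <- s) l %| x.
Proof.
elim: s => [|l s IH] /=; first by rewrite big_nil dvd1n.
case/andP=> ls us /andP[pl ps] H; rewrite big_cons Gauss_dvd; last first.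
  have := coprime_prod_primes l s (fun=> 1) pl ls ps.
  by under eq_bigr do rewrite expn1.
rewrite H ?mem_head //=; apply: IH => // r rs; apply: H.
by rewrite in_cons rs orbT.
Qed.

Lemma prime_dvd_fact l n : prime l -> (l %| n`!) = (l <= n).
Proof.
move=> pl; elim: n => [|n IH]; first by rewrite fact0 Euclid_dvd1 // leqn0; case: l pl.
rewrite factS Euclid_dvdM // IH; apply/orP/idP => [[/dvdn_leq->//|/leqW//]|].
by rewrite leq_eqVlt => /orP[/eqP->|]; [left | right].
Qed.

(** The two equal middle coefficients of [(1 + 1) ^ (2m + 1)] sum to at most [2 * 4 ^ m]. *)
Lemma bin_central_odd m : 'C(2 * m + 1, m) <= 4 ^ m.
Proof.
have H : 'C(2 * m + 1, m) + 'C(2 * m + 1, m.+1) <= 2 ^ (2 * m + 1).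
  rewrite -{3}(addn1 1) expnDn (bigD1 (inord m)) //= (bigD1 (inord m.+1)) /=; last first.
    by apply/eqP => /(congr1 val); rewrite /= !inordK; lia.
  by rewrite !exp1n !muln1 !inordK ?addnA ?leq_addr //; lia.
have E : 'C(2 * m + 1, m.+1) = 'C(2 * m + 1, m).
  have mn : m <= 2 * m + 1 by lia.
  by rewrite -(bin_sub mn); congr 'C(_, _); clear; lia.
by move: H; rewrite E expnD expnM expn1 addnn -muln2 leq_pmul2r.
Qed.

Definition primorial n := \prod_(0 <= l < n.+1 | prime l) l.

(** Chebyshev's bound by Erdős's induction: for [n = 2m + 1] the primes from [m + 2] to [n] all
    divide ['C(2m + 1, m)], while an even [n > 2] contributes no prime. *)
Lemma leq_primorial n : primorial n <= 4 ^ n.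
Proof.
elim/ltn_ind: n => n IH.
have [n3|n3] := ltnP n 3.
  case: n n3 IH => [|[|[|n]]] // _ _; rewrite /primorial unlock /=; by [].
have [no|ne] := boolP (odd n); last first.
  rewrite /primorial big_mkcond big_nat_recr //= -big_mkcond /=.
  have -> : prime n = false.
    by apply/negP => /even_prime[]; [lia | apply/negP].
  rewrite muln1; have := IH n.-1; rewrite /primorial prednK; last by lia.
  by move=> H; apply: leq_trans (H _) _; rewrite ?leq_exp2l //; lia.
have [m En] : exists m, n = 2 * m + 1 by exists n./2; lia.
rewrite /primorial (@big_cat_nat _ _ _ m.+2) //=; last by lia.
have H1 := IH m.+1 ltac:(lia).
have H2 : \prod_(m.+2 <= l < n.+1 | prime l) l <= 4 ^ m.
  apply: (leq_trans _ (bin_central_odd m)); apply: dvdn_leq; first by rewrite bin_gt0; lia.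
  rewrite -big_filter; apply: prod_primes_dvdn; rewrite ?filter_uniq ?iota_uniq ?filter_all //.
  move=> l; rewrite mem_filter mem_index_iota => /andP[pl /andP[l1 l2]].
  have mn : m <= 2 * m + 1 by lia.
  have := prime_dvd_fact l (2 * m + 1) pl.
  rewrite -(bin_fact mn) Euclid_dvdM // Euclid_dvdM // !prime_dvd_fact //.
  by case: (l %| _) => //=; lia.
apply: leq_trans (leq_mul H1 H2) _.
by rewrite -expnD leq_exp2l //; lia.
Qed.

Lemma leq_prod_subset (s1 s2 : seq nat) : uniq s1 -> {subset s1 <= s2} -> all (leq 1) s2 ->
  \prod_(l <- s1) l <= \prod_(l <- s2) l.
Proof.
elim: s1 s2 => [|l s1 IH] s2 /=.
  rewrite big_nil big_seq => _ _ /allP H; apply: prodn_cond_gt0 => i /H //.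
case/andP=> ls us sub As; have ls2 : l \in s2 by apply: sub; rewrite mem_head.
rewrite big_cons (perm_big _ (perm_to_rem ls2)) big_cons /= leq_mul2l; apply/orP; right.
apply: IH => //; last by apply/allP => x /mem_rem; apply: (allP As).
move=> x xs; have xl : x != l by apply: contraNneq ls => <-.
have := sub x; rewrite (perm_mem (perm_to_rem ls2)) !in_cons xs orbT (negPf xl) /=; exact.
Qed.

(** The product starts at 5 because it will bound a product of distinct prime exponents, all greater
    than 4. *)
Definition primeprod n := \prod_(5 <= l < n.+1 | prime l) l.

Lemma leq_primeprod n : primeprod n <= 4 ^ n.
Proof.
apply: (leq_trans _ (leq_primorial n)).
rewrite /primeprod /primorial -big_filter -[X in _ <= X]big_filter.
apply: leq_prod_subset; rewrite ?filter_uniq ?iota_uniq //.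
  by move=> l; rewrite !mem_filter !mem_index_iota => /and3P[-> _ ->].
by apply/allP => l; rewrite mem_filter => /andP[/prime_gt0].
Qed.

(** * Growth of the size bound *)

Lemma quartic_leq_exp4 u : 20 <= u -> 2 ^ 21 * u ^ 4 <= 4 ^ u.
Proof.
move=> u20; have -> : u = (u - 20) + 20 by lia.
elim: (u - 20) => [|v IH].
  rewrite add0n -[4 ^ 20]/((2 ^ 2) ^ 20) -expnM -[2 * 20]/(21 + 19) expnD leq_mul2l.
  apply/orP; right; rewrite -[4]/(2 * 2) expnM.
  apply: (@leq_trans ((2 ^ 9) ^ 2)); first by rewrite leq_exp2r.
  by rewrite -expnM leq_exp2l.
rewrite addSn [X in _ <= X]expnS; apply: (@leq_trans (4 * (2 ^ 21 * (v + 20) ^ 4))); last first.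
  by rewrite leq_mul2l IH.
rewrite mulnCA leq_mul2l; apply/orP; right.
move: (v + 20) (leq_addl v 20) => w w20.
have E x : x ^ 4 = (x * x) * (x * x) by rewrite !expnS expn0; lia.
have H : w.+1 * w.+1 <= 2 * (w * w) by nia.
by rewrite !E; apply: leq_trans (leq_mul H H) _; lia.
Qed.

(** For a prime [p < 16 ^ t] with all exponents at least 5, the first bracket bounds the product of
    the exponents, and [3 * t * 2 ^ t] bounds the sum of the [r - 1]: there are at most [3t] bases,
    each below [2 ^ t]. *)
Definition repunit_size_bound t :=
  2 * ((3 * t + 1) * ((2 * t + 1) * (2 * t + 1)) * primeprod (5 * t %/ 4 + 1)) * (3 * t * 2 ^ t).

Fixpoint primeprodN (l n : nat) : N :=
  if n is n'.+1 then
    (if prime l then N.of_nat l * primeprodN l.+1 n' else primeprodN l.+1 n')%num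
  else 1%num.

Lemma primeprodNE n : N.of_nat (primeprod n) = primeprodN 5 (n.+1 - 5).
Proof.
rewrite /primeprod /index_iota; move: 5 (n.+1 - 5) => l k.
elim: k l => [|k IH] l /=; first by rewrite big_nil.
by rewrite big_cons -IH; case: (prime l); rewrite ?of_natM.
Qed.

Lemma repunit_size_bound_small t : 16 <= t < 84 -> repunit_size_bound t <= 16 ^ t.-1.
Proof.
move=> Ht; apply: leq_of_N.
rewrite /repunit_size_bound !of_natM !of_nat_expn primeprodNE.
have /allP/(_ t) H : all (fun t => (N.of_nat 2 *
   (N.of_nat (3 * t + 1) * (N.of_nat (2 * t + 1) * N.of_nat (2 * t + 1)) *
    primeprodN 5 ((5 * t %/ 4 + 1).+1 - 5)) *
   (N.of_nat 3 * N.of_nat t * N.of_nat 2 ^ N.of_nat t)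
     <=? N.of_nat 16 ^ N.of_nat t.-1)%num) (iota 16 68).
  by vm_compute.
by apply: H; rewrite mem_iota; lia.
Qed.

(** By Chebyshev's bound the left side is [2 ^ (5t/2 + t)] times a quartic in [t], against
    [2 ^ (4t)] on the right. The gap absorbs the quartic from [t = 84] on; smaller [t] are
    computed. *)
Lemma leq_repunit_size_bound t : 16 <= t -> repunit_size_bound t <= 16 ^ t.-1.
Proof.
move=> t16; have [lt|ge] := ltnP t 84; first by apply: repunit_size_bound_small; rewrite t16.
pose u := t %/ 4; pose v := t %% 4.
have Et : t = 4 * u + v by rewrite /u /v; lia.
have [u20 v4] : 20 <= u /\ v < 4 by lia.
have e5 : 5 * t %/ 4 + 1 <= 5 * u + v + 1 by lia.
have H1 : primeprod (5 * t %/ 4 + 1) <= 4 ^ (5 * u + v + 1).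
  by apply: leq_trans (leq_primeprod _) _; rewrite leq_exp2l.
(* The constant is [13 * 9 * 9 * 13 = 13689 < 2 ^ 14]. *)
have H2 : (3 * t + 1) * ((2 * t + 1) * (2 * t + 1)) * (3 * t) <= 2 ^ 14 * u ^ 4.
  apply: (@leq_trans ((13 * u) * ((9 * u) * (9 * u)) * (13 * u))).
    by apply: leq_mul (leq_mul _ (leq_mul _ _)) _; lia.
  rewrite (_ : 13 * u * (9 * u * (9 * u)) * (13 * u) = (13 * 9 * 9 * 13) * u ^ 4);
    last by rewrite !expnS; lia.
  by rewrite leq_mul2r; apply/orP; right; lia.
have H3 := quartic_leq_exp4 u u20.
rewrite /repunit_size_bound.
set A := (3 * t + 1) * _ in H2 *; set P := primeprod _ in H1 *.
have -> : 2 * (A * P) * (3 * t * 2 ^ t) = 2 * (A * (3 * t)) * (P * 2 ^ t) by lia.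
apply: leq_trans (leq_mul (leq_mul (leqnn 2) H2) (leq_mul H1 (leqnn (2 ^ t)))) _.
have -> : 4 ^ (5 * u + v + 1) = 2 ^ (10 * u + 2 * v + 2).
  by rewrite (_ : 10 * u + 2 * v + 2 = 2 * (5 * u + v + 1)) ?expnM //; lia.
have -> : 16 ^ t.-1 = 2 ^ (16 * u + 4 * v - 4).
  by rewrite (_ : 16 * u + _ - _ = 4 * t.-1) ?expnM //; lia.
have E : 2 * 2 ^ 14 * (2 ^ (10 * u + 2 * v + 2) * 2 ^ t) = 2 ^ 21 * 2 ^ (14 * u + 3 * v - 4).
  by rewrite -expnS -!expnD; congr (2 ^ _); lia.
rewrite [2 * (2 ^ 14 * _)]mulnA [_ * u ^ 4 * _]mulnAC E mulnAC.
apply: leq_trans (leq_mul H3 (leqnn _)) _.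
rewrite -[4 ^ u]/((2 ^ 2) ^ u) -expnM -expnD leq_exp2l //; lia.
Qed.

(** * Repunit representations of a prime *)

(** In the application [T] consists of the primes [r] dividing [m] with [j_r = 1], and [n r] is
    [2 e_r + 1]. *)
Definition repunit_family (p : nat) (T : seq nat) (n : nat -> nat) : Prop :=
  [/\ prime p, uniq T &
      forall r, r \in T -> [/\ prime r, odd r, odd (n r), 1 < n r & repunit r (n r) = p]].

(** A factorisation [n = d * k] splits the repunit into [repunit r d] and [repunit (r ^ d) k], both
    greater than 1. *)
Lemma repunit_prime_exponent r n : 1 < r -> 1 < n -> prime (repunit r n) -> prime n.
Proof.
move=> r1 n1 pp; apply/negPn/negP => /primePn[|[d /andP[d1 dn] /dvdnP[k En]]]; first by lia.
have k1 : 1 < k by nia.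
have rd1 : 1 < r ^ d by rewrite -(exp1n d) ltn_exp2r //; lia.
have gt x m : 1 < x -> 1 < m -> 1 < repunit x m.
  move=> x1 m1; apply: leq_ltn_trans (expn_ltn_repunit x m x1 m1).
  by rewrite expn_gt0; lia.
have A := gt _ _ r1 d1; have B := gt _ _ rd1 k1.
move: pp; rewrite En mulnC repunitM => pp.
have /(prime_nt_dvdP pp) E : repunit r d %| repunit r d * repunit (r ^ d) k by rewrite dvdn_mulr.
have := E ltac:(lia); nia.
Qed.

(** With [p] the repunit, [(r - 1)(p - 1) = r ^ n - r] is divisible by [n] by Fermat. If [n] divided
    [r - 1], all summands of [p] would be 1 modulo [n], so [n] would divide the larger prime [p]. *)
Lemma repunit_exponent_dvd r n : 1 < r -> prime n -> prime (repunit r n) -> n %| (repunit r n).-1.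
Proof.
move=> r1 pn pp; have n1 := prime_gt1 pn.
have := expn_ltn_repunit r n r1 n1; have : n.-1 < r ^ n.-1 by rewrite ltn_expl.
set p := repunit r n in pp * => np1 np2.
have E : r.-1 * p + 1 = r ^ n by apply: repunit_pred; lia.
have F : r ^ n = r %[mod n] by apply: fermat_little.
have : n %| r.-1 * p.-1.
  rewrite (_ : r.-1 * p.-1 = r ^ n - r); last by nia.
  by rewrite -eqn_mod_dvd ?F //; nia.
rewrite Euclid_dvdM // => /orP[nr|//].
suff : n %| p by rewrite dvdn_prime2 // => /eqP; lia.
have -> : p = \sum_(i < n) r ^ i by [].
have H i : r ^ i = 1 %[mod n].
  have -> : r = r.-1 + 1 by lia.
  by rewrite -modnXm -modnDml (eqP nr) add0n modnXm exp1n.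
rewrite /dvdn; rewrite -modn_summ.
under eq_bigr do rewrite H.
by rewrite modn_summ sum1_card card_ord modnn.
Qed.

Lemma repunit_family_exponent p T n r : repunit_family p T n -> r \in T ->
  [/\ 2 < r, prime (n r), n r %| p.-1, r %| p.-1 & r ^ (n r).-1 < p].
Proof.
case=> pp _ H rT; have [pr ro no n1 E] := H r rT.
have r1 := prime_gt1 pr; have pn : prime (n r).
  by apply: (repunit_prime_exponent r) => //; rewrite E.
split=> //; last by rewrite -E expn_ltn_repunit.
- by have := odd_prime_gt2 ro pr.
- by rewrite -E; apply: repunit_exponent_dvd => //; rewrite E.
- by rewrite -E; case: (n r) n1 => // k _; rewrite repunitSl /= dvdn_mulr.
Qed.

Lemma repunit_family_inj p T n : repunit_family p T n -> {in T &, injective n}.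
Proof.
case=> _ _ H r s /H[_ _ _ n1 Er] /H[_ _ _ _ Es] E.
apply/eqP/negPn/negP; rewrite neq_ltn => /orP[lt|lt];
  by have := ltn_repunit _ _ (n r) n1 lt; rewrite Er E Es ltnn.
Qed.

Lemma repunit_family_uniq p T n : repunit_family p T n -> uniq (map n T).
Proof.
by move=> F; have [_ uT _] := F; rewrite map_inj_in_uniq //; apply: repunit_family_inj F.
Qed.

(** * Comparison of the exponent sum with the prime *)

Definition exponent_prod (T : seq nat) (n : nat -> nat) := \prod_(r <- T) n r.

(* [M * sum (r - 1) (1 - 1 / n_r)], the quotients being exact. *)
Definition exponent_sum (T : seq nat) (n : nat -> nat) :=
  \sum_(r <- T) r.-1 * (n r).-1 * (exponent_prod T n %/ n r).

Lemma leq_exponent_sum M (T : seq nat) (n : nat -> nat) :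
  \sum_(r <- T) r.-1 * (n r).-1 * (M %/ n r) <= M * \sum_(r <- T) r.-1.
Proof.
rewrite big_distrr /=; apply: leq_sum => r _; rewrite -mulnA [M * _]mulnC leq_mul2l.
apply/orP; right; apply: leq_trans (leq_trunc_div M (n r)).
by rewrite mulnC leq_mul2l leq_pred orbT.
Qed.

(** The additive 2 is kept so that [2 * prod <= y + 1] yields [3 * sum <= y - 1]. *)
Lemma sum_leq_prod (s : seq nat) : 1 < size s -> all (leq 3) s ->
  3 * (\sum_(r <- s) r.-1) + 2 <= 2 * \prod_(r <- s) r.
Proof.
case: s => [|a [|b s]] // _; elim: s a b => [|c s IH] a b /=.
  by rewrite !big_cons !big_nil => /and3P[a3 b3 _]; nia.
move=> /and3P[a3 b3 /andP[c3 Hs]]; have := IH b c; rewrite /= b3 c3 Hs => /(_ isT).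
have : 2 <= \sum_(r <- [:: b, c & s]) r.-1 by rewrite big_cons; lia.
rewrite [\sum_(r <- [:: a, b, c & s]) _]big_cons [\prod_(r <- [:: a, b, c & s]) _]big_cons.
by move: (\sum_(r <- _) _) (\prod_(r <- _) _) => S P; nia.
Qed.

Lemma double_odd_dvdn x M : odd M -> ~~ odd x -> M %| x -> 2 * M %| x.
Proof. by move=> Mo xe Mx; rewrite Gauss_dvd ?coprime2n // dvdn2 xe. Qed.

Lemma odd_prod (s : seq nat) : all odd s -> odd (\prod_(x <- s) x).
Proof.
by elim: s => [|x s IH] /=; rewrite ?big_nil // big_cons oddM => /andP[-> /IH].
Qed.

Lemma leq_repunit_quadratic r y : 2 < r -> r ^ 4 < y * y + y + 1 -> 3 * r.-1 <= y.-1.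
Proof.
move=> r2 lt; rewrite leqNgt; apply/negP => gt.
have H : y * y + y + 1 <= 9 * (r * r).
  have H1 : y <= 3 * r - 3 by lia.
  by apply: (@leq_trans ((3 * r - 3) * (3 * r - 3) + (3 * r - 3) + 1)); nia.
have H2 : 9 * (r * r) <= r ^ 4 by rewrite !expnS expn0 muln1; nia.
by have := leq_trans H H2; rewrite leqNgt lt.
Qed.

(* If [p = y ^ 2 + y + 1], every other base and every exponent divides [p - 1 = y (y + 1)],
   hence [y + 1]. *)
Lemma exponent_sum_lt_three p T n y : repunit_family p T n -> y \in T -> n y = 3 ->
  2 * exponent_sum T n < p + exponent_prod T n.
Proof.
move=> F yT ny; have [pp uT H] := F.
have [py yo _ _ Ep] := H y yT; rewrite ny in Ep.
have {}Ep : p = y * y + y + 1 by rewrite -Ep !repunitS repunit0 !expnS expn0; lia.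
have y2 := odd_prime_gt2 yo py.
pose T' := rem y T; have PT : perm_eq T (y :: T') := perm_to_rem yT.
have uT' : uniq (y :: T') by rewrite -(perm_uniq PT).
have sub r : r \in T' -> [/\ r \in T, r != y & 4 < n r].
  move=> rT'; have rT : r \in T by apply: mem_rem rT'.
  have ry : r != y by apply: contraTneq rT' => ->; case/andP: uT'.
  have [_ pn _ _ _] := repunit_family_exponent _ _ _ _ F rT.
  have [_ _ no n1 _] := H r rT.
  have n3 : n r != 3.
    by rewrite -ny; apply: contraNneq ry => E; apply/eqP; apply: (repunit_family_inj _ _ _ F).
  by split=> //; case: (n r) n1 n3 no pn => [|[|[|[|[|k]]]]].
(* As [3 ^ (n r - 1) < p = y ^ 2 + y + 1], the exponent [n r] stays below [y]. So it differs from
   [y] and, dividing [y (y + 1)], must divide [y + 1]. *)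
have small r : r \in T' -> n r < y /\ 81 < p.
  move=> /sub[rT ry n4]; have [r2 _ _ _ lt] := repunit_family_exponent _ _ _ _ F rT.
  have le : 3 ^ (n r).-1 < p.
    by apply: leq_ltn_trans lt; rewrite leq_exp2r //; lia.
  have le81 : 81 < p.
    by apply: leq_ltn_trans le; rewrite -[81]/(3 ^ 4) leq_exp2l //; lia.
  split=> //; rewrite ltnNge; apply/negP => yn.
  have key k : 4 <= k -> k.+1 * k.+1 + k.+1 + 1 <= 3 ^ k.
    elim: k => // k IH k4; have [->//|k4'] := eqVneq k 3.
    by rewrite expnS; have := IH ltac:(lia); nia.
  by have := key (n r).-1 ltac:(lia); nia.
have yp1 : p.-1 = y * y.+1 by lia.
have ye : ~~ odd y.+1 by rewrite /= yo.
have [T0|/eqP T'0] := eqVneq T' [::].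
  rewrite /exponent_sum /exponent_prod !(perm_big _ PT) /= T0 !big_seq1 ny divnn /=; nia.
have [r0 r0T] : exists r, r \in T' by case: (T') T'0 => // r s _; exists r; rewrite mem_head.
have [_ p81] := small r0 r0T.
set M := exponent_prod T n.
(* The exponents are distinct odd primes dividing the even number [y + 1]; the exponent 3 could
   equal [y] only for [p = 13], excluded by [81 < p]. *)
have M2 : 2 * M <= y.+1.
  apply: dvdn_leq => //; apply: double_odd_dvdn => //.
    rewrite /M /exponent_prod -(big_map n xpredT id); apply: odd_prod.
    by apply/allP => _ /mapP[r /H[_ _ no _ _] ->].
  rewrite /M /exponent_prod -(big_map n xpredT id); apply: prod_primes_dvdn.
  - exact: repunit_family_uniq F.
  - by apply/allP => _ /mapP[r rT ->]; have [] := repunit_family_exponent _ _ _ _ F rT.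
  move=> _ /mapP[r rT ->]; have [_ pn nd _ _] := repunit_family_exponent _ _ _ _ F rT.
  move: nd; rewrite yp1 Euclid_dvdM // => /orP[|//]; rewrite dvdn_prime2 // => /eqP E.
  move: rT; rewrite (perm_mem PT) in_cons => /orP[/eqP Er|/small[]]; last by rewrite E ltnn.
  by move: p81; rewrite Ep -E Er ny.
(* Two or more other bases have a product whose double divides [y + 1]; a single one satisfies
   [r ^ 4 < p]. *)
have S3 : 3 * (\sum_(r <- T') r.-1) <= y.-1.
  case E : T' T'0 => [|r [|s T2]] // _; last first.
    rewrite -E; have R2 : 2 * \prod_(r <- T') r <= y.+1.
      apply: dvdn_leq => //; apply: double_odd_dvdn => //.
        by apply: odd_prod; apply/allP => r' /sub[/H[]].
      apply: prod_primes_dvdn; first by case/andP: uT'.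
        by apply/allP => r' /sub[/H[]].
      move=> r' /sub[rT ry _]; have [_ _ _ rd _] := repunit_family_exponent _ _ _ _ F rT.
      have [pr _ _ _ _] := H r' rT.
      by move: rd; rewrite yp1 Euclid_dvdM // dvdn_prime2 // (negPf ry).
    have := sum_leq_prod T'; rewrite {1}E => /(_ isT) HH.
    have : all (leq 3) T'.
      by apply/allP => r' /sub[rT _ _]; have [] := repunit_family_exponent _ _ _ _ F rT.
    move/HH => {}HH; have := leq_trans HH R2.
    by move: (\sum_(r <- _) _) => S; clear -y2; lia.
  rewrite big_seq1; have rT' : r \in T' by rewrite E mem_head.
  have [rT _ n4] := sub r rT'; have [r2 _ _ _ lt] := repunit_family_exponent _ _ _ _ F rT.
  have : r ^ 4 < p.
    by apply: leq_ltn_trans lt; rewrite leq_exp2l; [move: n4; clear; lia | exact: ltnW].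
  by rewrite Ep => /(leq_repunit_quadratic _ _ r2).
have M3 : M = 3 * (M %/ 3).
  rewrite mulnC divnK // /M /exponent_prod (perm_big _ PT) /= big_cons ny dvdn_mulr //.
(* The base [y] contributes [2/3 M (y - 1)] and the others at most [1/3 M (y - 1)], so the doubled
   sum is at most [2 M (y - 1) <= (y + 1)(y - 1) < p]. *)
have E : exponent_sum T n <= y.-1 * 2 * (M %/ 3) + M * \sum_(r <- T') r.-1.
  rewrite /exponent_sum -/M (perm_big _ PT) /= big_cons ny leq_add2l.
  exact: leq_exponent_sum.
move: E M2 S3 M3; move: (\sum_(r <- T') _) (exponent_sum _ _) (M %/ 3) => S W K E M2 S3 M3.
rewrite Ep; move: E M2 S3 y2; rewrite M3; clear => E M2 S3 y2.
have : 2 * W <= 2 * (3 * K) * y.-1 by nia.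
have : 2 * (3 * K) * y.-1 <= y.+1 * y.-1 by rewrite leq_mul2r M2 orbT.
by nia.
Qed.

Lemma leq_prod_seq (T s : seq nat) (n L : nat -> nat) :
  uniq T -> uniq s -> {in s, forall r, 0 < L r} -> {in T, forall r, n r <= L r} ->
  \prod_(r <- T | r \in s) n r <= \prod_(r <- s) L r.
Proof.
move=> uT us L0 nL; rewrite -big_filter.
have P : perm_eq [seq r <- T | r \in s] [seq r <- s | r \in T].
  by apply: uniq_perm; rewrite ?filter_uniq // => x; rewrite !mem_filter andbC.
rewrite (perm_big _ P) big_filter big_mkcond big_seq [X in _ <= X]big_seq.
by apply: leq_prod => r rs; case: ifP => [/nL|_]; last exact: L0.
Qed.

(** The hypothesis [16 ^ d <= r ^ c] encodes the lower bound [d / c] on the logarithm of [r] in base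
    16. *)
Lemma exponent_bound r m t c d : 1 < r -> 0 < d -> 0 < m -> 16 ^ d <= r ^ c ->
  r ^ m.-1 < 16 ^ t -> m <= c * t %/ d + 1.
Proof.
move=> r1 d0 m0 le lt.
have : r ^ (m.-1 * d) < r ^ (c * t).
  rewrite expnM; apply: (@leq_trans ((16 ^ t) ^ d)); first by rewrite ltn_exp2r.
  by rewrite -expnM mulnC !expnM; case: t {lt} => // t; rewrite leq_exp2r.
rewrite ltn_exp2l // => {}lt.
have : m.-1 <= c * t %/ d by rewrite leq_divRL // ltnW.
by lia.
Qed.

(* The four factors bound the exponents attached to [r = 3], [5], [7] and [r >= 11]; they come
   from [3 ^ 3 >= 16], [5 ^ 2 >= 16], [7 ^ 2 >= 16] and [11 ^ 5 >= 16 ^ 4]. *)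
Lemma exponent_prod_bound p T n t : repunit_family p T n -> {in T, forall r, 4 < n r} ->
  p < 16 ^ t ->
  exponent_prod T n <= (3 * t + 1) * ((2 * t + 1) * (2 * t + 1)) * primeprod (5 * t %/ 4 + 1).
Proof.
move=> F n4 pt; have [pp uT H] := F.
have bnd r c d : r \in T -> 0 < d -> 16 ^ d <= r ^ c -> n r <= c * t %/ d + 1.
  move=> rT d0 le; have [r2 _ _ _ lt] := repunit_family_exponent _ _ _ _ F rT.
  have := n4 r rT => nr4.
  by apply: (exponent_bound r) => //; [lia | lia | apply: ltn_trans lt pt].
pose L r := if r == 3 then 3 * t + 1 else 2 * t + 1.
rewrite /exponent_prod (bigID (fun r => r \in [:: 3; 5; 7])) /=; apply: leq_mul.
  have -> : (3 * t + 1) * ((2 * t + 1) * (2 * t + 1)) = \prod_(r <- [:: 3; 5; 7]) L r.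
    by rewrite !big_cons big_nil muln1.
  rewrite -big_filter (eq_filter (a2 := fun r => (r \in [:: 3; 5; 7]))) // big_filter.
  pose T7 := [seq r <- T | r \in [:: 3; 5; 7]].
  have -> : \prod_(r <- T | r \in [:: 3; 5; 7]) n r = \prod_(r <- T7 | r \in [:: 3; 5; 7]) n r.
    by rewrite -[RHS]big_filter /T7 filter_id big_filter.
  apply: leq_prod_seq => //; first by rewrite filter_uniq.
    by move=> r _; rewrite /L; case: ifP; lia.
  move=> r; rewrite mem_filter => /andP[r7 rT]; rewrite /L; case: ifP => [/eqP r3|r3].
    by have := bnd r 3 1 rT; rewrite r3 divn1; apply.
  have := bnd r 2 1 rT; rewrite divn1; apply=> //.
  by move: r7; rewrite !inE r3 /= => /orP[]/eqP->.
(* For [r >= 11] the exponents are distinct primes between 5 and [5t/4 + 1]. *)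
rewrite -big_filter -(big_map n xpredT id) /primeprod -[X in _ <= X]big_filter.
set s := [seq r <- T | _].
have sT r : r \in s -> r \in T /\ 10 < r.
  rewrite mem_filter !inE => /andP[r7 rT]; split=> //.
  have [pr ro _ _ _] := H r rT.
  by rewrite ltnNge; apply/negP; move: r7 pr ro; do 11 case: r => [//|r] in rT *.
apply: leq_prod_subset.
- rewrite map_inj_in_uniq ?filter_uniq // => r r' /sT[rT _] /sT[rT' _].
  by apply: (repunit_family_inj _ _ _ F).
- move=> _ /mapP[r /sT[rT r10] ->]; have [_ pn _ _ _] := repunit_family_exponent _ _ _ _ F rT.
  rewrite mem_filter pn mem_index_iota n4 //= ltnS; apply: bnd => //.
  apply: (@leq_trans (11 ^ 5)); last by rewrite leq_exp2r.
  by apply: leq_of_N; rewrite !of_nat_expn; vm_compute.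
by apply/allP => l; rewrite mem_filter => /andP[/prime_gt0].
Qed.

(** With [16 ^ (t - 1) <= p < 16 ^ t], the crude bound [2 M sum (r - 1)] is already at most [p]. *)
Lemma exponent_sum_lt_large p T n : repunit_family p T n -> {in T, forall r, 4 < n r} ->
  16 ^ 15 <= p -> 2 * exponent_sum T n < p + exponent_prod T n.
Proof.
move=> F n4 pB; have [pp uT H] := F.
have p0 := prime_gt0 pp.
have /andP[lo hi] := trunc_log_bounds (isT : 1 < 16) p0.
have t15 := trunc_log_max (isT : 1 < 16) pB.
set t := (trunc_log 16 p).+1 in hi.
have t16 : 16 <= t by rewrite /t ltnS.
have bnd := leq_repunit_size_bound t t16; rewrite /t /= -/t in bnd.
have HM := exponent_prod_bound p T n t F n4 hi.
have M0 : 0 < exponent_prod T n.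
  by rewrite /exponent_prod big_seq; apply: prodn_cond_gt0 => r /H[_ _ _ n1 _]; exact: ltnW.
have rt r : r \in T -> r < 2 ^ t.
  move=> rT; have [r2 _ _ _ lt] := repunit_family_exponent _ _ _ _ F rT.
  rewrite ltnNge; apply/negP => le.
  have : 16 ^ t <= r ^ (n r).-1.
    apply: (@leq_trans (r ^ 4)); last by rewrite leq_exp2l; have := n4 r rT; lia.
    by rewrite -[16]/(2 ^ 4) -expnM mulnC expnM leq_exp2r.
  by rewrite leqNgt (ltn_trans lt hi).
have HT : size T <= 3 * t.
  rewrite -(size_map n) -(size_iota 2 (3 * t)); apply: uniq_leq_size.
    exact: repunit_family_uniq F.
  move=> _ /mapP[r rT ->]; rewrite mem_iota.
  have [r2 _ _ _ lt] := repunit_family_exponent _ _ _ _ F rT.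
  have n4r := n4 r rT.
  have : n r <= 3 * t %/ 1 + 1.
    apply: (exponent_bound r) => //; [lia | lia | | exact: ltn_trans lt hi].
    by apply: (@leq_trans (3 ^ 3)); rewrite ?leq_exp2r.
  by rewrite divn1; lia.
have HS : \sum_(r <- T) r.-1 <= 3 * t * 2 ^ t.
  apply: (@leq_trans (\sum_(r <- T) 2 ^ t)).
    by rewrite big_seq [X in _ <= X]big_seq; apply: leq_sum => r /rt lt; lia.
  by rewrite big_const_seq count_predT iter_addn_0 mulnC leq_mul2r HT orbT.
apply: (@leq_ltn_trans p); last by rewrite -{1}(addn0 p) ltn_add2l.
apply: leq_trans lo; apply: leq_trans bnd.
rewrite /repunit_size_bound -mulnA leq_mul2l /=.
apply: leq_trans (leq_exponent_sum _ _ _) _.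
exact: leq_mul.
Qed.

(** Three cases: some exponent is 3; there is at most one base; or two bases have distinct exponents
    at least 5, and then the computation forces [p >= 2 ^ 60 = 16 ^ 15]. *)
Lemma exponent_sum_lt p T n : repunit_family p T n ->
  2 * exponent_sum T n < p + exponent_prod T n.
Proof.
move=> F; have [pp uT H] := F.
have [/hasP[y yT /eqP ny]|/hasPn n3] := boolP (has (fun r => n r == 3) T).
  exact: exponent_sum_lt_three F yT ny.
have n4 : {in T, forall r, 4 < n r}.
  move=> r rT; have := n3 r rT; have [_ _ no n1 _] := H r rT.
  by case: (n r) n1 no => [|[|[|[|[|k]]]]].
have p0 := prime_gt0 pp.
case: T F uT H n4 {n3} => [|r [|s T]] F uT H n4.
- by rewrite /exponent_sum /exponent_prod !big_nil addn_gt0 p0.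
- rewrite /exponent_sum /exponent_prod !big_seq1.
  have rT := mem_head r [::]; have [r2 _ _ _ lt] := repunit_family_exponent _ _ _ _ F rT.
  have n4r := n4 r rT; rewrite divnn (ltnW (ltnW (ltnW (ltnW n4r)))) muln1.
  have key k : 3 <= k -> 2 * k.+1 <= r ^ k.
    move=> k3; apply: (@leq_trans (3 ^ k)); last by rewrite leq_exp2r //; lia.
    elim: k k3 => // k IH k3; have [->//|k4] := eqVneq k 2.
    by rewrite expnS; have := IH ltac:(lia); lia.
  have := key (n r).-2 ltac:(lia).
  have -> : (n r).-2.+1 = (n r).-1 by lia.
  have E : r ^ (n r).-1 = r * r ^ (n r).-2 by rewrite -expnS; congr (r ^ _); lia.
  by rewrite E in lt; nia.
apply: exponent_sum_lt_large => //.
have rT := mem_head r (s :: T).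
have sT : s \in [:: r, s & T] by rewrite !in_cons eqxx orbT.
have rs : n r != n s.
  apply/eqP => E; have := repunit_family_inj _ _ _ F r s rT sT E => rs.
  by move: uT; rewrite rs /= mem_head.
have EB : N.of_nat (16 ^ 15) = (2 ^ 60)%num by rewrite of_nat_expn; vm_compute.
move: (16 ^ 15) EB => B EB.
have [pr ro nor n1r Er] := H r rT; have [ps so nos n1s Es] := H s sT.
have key u v : n v < n u -> u \in [:: r, s & T] -> v \in [:: r, s & T] -> B <= p.
  move=> lt uT' vT'; have [u2 _ _ _ _] := repunit_family_exponent _ _ _ _ F uT'.
  have [_ _ nou _ Eu] := H u uT'; have [_ _ nov _ Ev] := H v vT'.
  rewrite -Eu; apply: (double_repunit_large _ u v (n u) (n v) EB) => //; first exact: n4.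
  by rewrite Eu Ev.
by move: rs; rewrite neq_ltn => /orP[lt|lt]; [apply: (key s r) | apply: (key r s)].
Qed.

(** * The congruence modulo [p ^ 2] *)

Lemma expn_1D_mod p t k : (1 + p * t) ^ k = 1 + p * (k * t) %[mod p ^ 2].
Proof.
suff [c ->] : exists c, (1 + p * t) ^ k = 1 + p * (k * t) + p ^ 2 * c.
  by rewrite addnC mulnC modnMDl.
elim: k => [|k [c IH]]; first by exists 0; rewrite expn0; lia.
by exists (k * t * t + c + p * t * c); rewrite expnS IH !expnS expn0; lia.
Qed.

Lemma prod_1D_mod p (s : seq nat) (f x : nat -> nat) :
  {in s, forall r, f r = 1 + p * x r %[mod p ^ 2]} ->
  \prod_(r <- s) f r = 1 + p * \sum_(r <- s) x r %[mod p ^ 2].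
Proof.
elim: s => [|r s IH] H; first by rewrite !big_nil muln0.
rewrite !big_cons -modnMm (H r) ?mem_head // IH; last first.
  by move=> r' rs; apply: H; rewrite in_cons rs orbT.
rewrite modnMm; set S := \sum_(_ <- _) _.
have -> : (1 + p * x r) * (1 + p * S) = (x r * S) * p ^ 2 + (1 + p * (x r + S)).
  by rewrite !expnS expn0; lia.
by rewrite modnMDl.
Qed.

(** The terms [1 + i p t] add up to [p + p t * p (p - 1) / 2], where [(p - 1) / 2] is an integer
    because [p] is odd. *)
Lemma repunit_1D_mod p t : odd p -> repunit (1 + p * t) p = p %[mod p ^ 2].
Proof.
move=> po; rewrite /repunit -modn_summ.
under eq_bigr do rewrite expn_1D_mod.
rewrite modn_summ big_split /= sum1_card card_ord -big_distrr /= -big_distrl /=.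
have -> : \sum_(i < p) val i = p * (p.-1)./2.
  have := bin2_sum p; rewrite big_mkord bin2 /= => ->.
  by rewrite -[RHS](doubleK) -muln2 -mulnA muln2 (_ : _./2.*2 = p.-1) //; lia.
rewrite (_ : p * (p * _ * t) = ((p.-1)./2 * t) * p ^ 2); last by rewrite !expnS expn0; lia.
by rewrite addnC modnMDl.
Qed.

(** If [n = k p], the factor [repunit (r ^ k) p] is a power of [p] exceeding [p], hence 0 modulo
    [p ^ 2]. But Fermat gives [r ^ k = r ^ n = 1] modulo [p], which makes this factor [p] modulo
    [p ^ 2]. *)
Lemma repunit_pfactor_coprime p r n j : prime p -> odd p -> 1 < r -> 0 < n ->
  repunit r n = p ^ j -> ~~ (p %| n).
Proof.
move=> pp po r1 n0 E; apply/negP => /dvdnP[k En].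
have p1 := prime_gt1 pp.
have k0 : 0 < k by move: n0; rewrite En; case: k {En}.
have x1 : 1 < r ^ k by rewrite -(exp1n k) ltn_exp2r.
have := E; rewrite En repunitM => E2.
have /(dvdn_pfactor _ _ pp)[i _ Ei] : repunit (r ^ k) p %| p ^ j by rewrite -E2 dvdn_mull.
have gt : p < repunit (r ^ k) p.
  apply: leq_ltn_trans (expn_ltn_repunit _ _ x1 p1).
  by have := ltn_expl p.-1 x1; lia.
have i2 : 1 < i by case: i Ei gt => [|[|i]] // ->; rewrite ?expn0 ?expn1; lia.
have j0 : 0 < j.
  case: j E {E2} => // E;  have n1 : 1 < n by nia.
  by have := expn_ltn_repunit r n r1 n1; rewrite E expn0 ltnS leqn0 expn_eq0; lia.
have : p %| r ^ k - 1.
  rewrite -eqn_mod_dvd; last exact: ltnW.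
  rewrite -(fermat_little (r ^ k) pp) -expnM -En -(repunit_pred r n); last exact: ltnW.
  by rewrite E -modnDml -{1}(prednK j0) expnS mulnCA -modnMml modnn mul0n mod0n add0n.
case/dvdnP => t Et; have {Et}Et : r ^ k = 1 + p * t by lia.
have := repunit_1D_mod p t po; rewrite -Et Ei.
have -> : p ^ i = p ^ (i - 2) * p ^ 2 by rewrite -expnD; congr (p ^ _); lia.
rewrite modnMl modn_small; first by lia.
by rewrite -{1}(expn1 p) ltn_exp2l.
Qed.

(** One term suffices: [2 (r - 1)(n_r - 1) > n_r] because [r >= 3] and [n_r >= 2]. *)
Lemma exponent_prod_lt_sum p T n : repunit_family p T n -> T <> [::] ->
  exponent_prod T n < 2 * exponent_sum T n.
Proof.
move=> F; have [_ _ H] := F; case: T F H => // r T F H _.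
have rT := mem_head r T; have [r2 _ _ _ _] := repunit_family_exponent _ _ _ _ F rT.
have [_ _ _ n1 _] := H r rT.
rewrite /exponent_sum big_cons.
have M0 : 0 < exponent_prod (r :: T) n.
  by rewrite /exponent_prod big_seq; apply: prodn_cond_gt0 => s /H[_ _ _ n1' _]; exact: ltnW.
have E : exponent_prod (r :: T) n = n r * (exponent_prod (r :: T) n %/ n r).
  by rewrite mulnC divnK // /exponent_prod big_cons dvdn_mulr.
rewrite mulnDr; apply: leq_trans (leq_addr _ _); rewrite {1}E.
have : 0 < exponent_prod (r :: T) n %/ n r by move: E M0; case: (_ %/ _) => // ->; rewrite muln0.
move: (_ %/ _) => K K0; rewrite mulnA ltn_pmul2r //.
by move: (n r) n1 r2; clear => k; nia.
Qed.

Lemma modn_coprime_mul2r d c a b : coprime d c -> a * c = b * c %[mod d] -> a = b %[mod d].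
Proof.
wlog le : a b / a <= b => [H co E|co /esym/eqP E].
  by case: (leqP a b) => [|/ltnW] le; [apply: H | apply/esym/H].
apply/esym/eqP; move: E; rewrite !eqn_mod_dvd ?leq_mul2r ?le ?orbT //.
by rewrite -mulnBl Gauss_dvdl.
Qed.

Lemma no_euler_pair p a m : prime p -> odd p -> 0 < a -> odd m ->
  sigma (m ^ 2) = p ^ (2 * a) -> 2 * m ^ 2 = 1 + repunit p (2 * a).+1 -> False.
Proof.
move=> pp po a0 mo Es Em.
have m0 : 0 < m by case: m mo {Es Em}.
pose n r := (2 * logn r m).+1.
pose B r := repunit r (n r) == p.
rewrite sigma_sqr // in Es.
have prim r : r \in primes m -> [/\ prime r, odd r, 2 < r & 1 < n r].
  rewrite mem_primes => /and3P[pr _ rm].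
  have ro : odd r by apply: dvdn_odd rm mo.
  split=> //; first exact: odd_prime_gt2.
  by rewrite /n ltnS muln_gt0 /= logn_gt0 mem_primes pr m0.
have pow r : r \in primes m -> exists j, repunit r (n r) = p ^ j.
  move=> rm; have : repunit r (n r) %| p ^ (2 * a).
    by rewrite -Es (perm_big _ (perm_to_rem rm)) big_cons dvdn_mulr.
  by case/(dvdn_pfactor _ _ pp) => j _ ->; exists j.
pose T := [seq r <- primes m | B r].
have F : repunit_family p T n.
  split=> //; first by rewrite filter_uniq // primes_uniq.
  move=> r; rewrite mem_filter => /andP[/eqP Br /prim[pr ro _ n1]]; split=> //.
  by rewrite /n /= oddM.
pose L := \prod_(r <- primes m | ~~ B r) n r.
pose M := exponent_prod T n.
pose W := exponent_sum T n.
have EQ : \prod_(r <- primes m) n r = M * L.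
  by rewrite (bigID B) /= /M /exponent_prod big_filter.
have pL : coprime p L.
  rewrite prime_coprime // /L Euclid_dvd_prod // big_has_cond; apply/hasPn => r rm.
  have [j Ej] := pow r rm; have [_ _ r2 n1] := prim r rm.
  by rewrite negb_and (repunit_pfactor_coprime p r (n r) j) ?orbT //; lia.
(* Raising to the product of all the exponents kills the roots of unity modulo [p ^ 2]. *)
pose x r := if B r then r.-1 * (n r).-1 * (M %/ n r) * L else 0.
have key : {in primes m, forall r, (r ^ (2 * logn r m)) ^ (M * L) = 1 + p * x r %[mod p ^ 2]}.
  move=> r rm; have [pr ro r2 n1] := prim r rm.
  have En : r.-1 * repunit r (n r) + 1 = r ^ n r by apply: repunit_pred; lia.
  have ->: 2 * logn r m = (n r).-1 by [].
  rewrite /x; case: ifP => Br.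
    have -> : M * L = n r * (M %/ n r * L).
      rewrite mulnA [n r * _]mulnC divnK // /M /exponent_prod.
      have rT : r \in T by rewrite mem_filter Br.
      by rewrite (perm_big _ (perm_to_rem rT)) big_cons dvdn_mulr.
    rewrite -expnM mulnCA expnM -En (eqP Br) mulnC [_ + 1]addnC mulnC [_.-1 * p]mulnC expn_1D_mod.
    by congr ((1 + p * _) %% _); lia.
  have [j Ej] := pow r rm.
  (* So [p ^ 2] divides the repunit and [r ^ n_r = 1] modulo [p ^ 2]. *)
  have j2 : 1 < j.
    case: j Ej => [|[|j]] // Ej; last by move: Br; rewrite /B Ej expn1 eqxx.
    have r1 : 1 < r by lia.
    have := expn_ltn_repunit r (n r) r1 n1; rewrite Ej expn0 ltnS leqn0 expn_eq0; lia.
  have : n r %| M * L by rewrite -EQ (perm_big _ (perm_to_rem rm)) big_cons dvdn_mulr.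
  case/dvdnP => Q ->; rewrite -expnM mulnCA mulnA [_ * n r]mulnC expnM -En Ej.
  have -> : p ^ j = p ^ 2 * p ^ (j - 2) by rewrite -expnD; congr (p ^ _); lia.
  rewrite -modnXm mulnCA -modnDml modnMr add0n modnXm exp1n muln0 addn0 //.
have {key} key := prod_1D_mod p (primes m) _ x key.
have Ex : \sum_(r <- primes m) x r = W * L.
  rewrite /W /exponent_sum big_distrl /= big_filter [RHS]big_mkcond /=.
  by apply: eq_bigr.
have Emm : \prod_(r <- primes m) (r ^ (2 * logn r m)) ^ (M * L) = (m ^ 2) ^ (M * L).
  rewrite [in RHS](prod_logn m m0) -expnM.
  elim: (primes m) => [|r s IH]; first by rewrite !big_nil exp1n.
  by rewrite !big_cons IH expnMn -!expnM; congr (r ^ _ * _); lia.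
rewrite Emm Ex in key.
have p2 := odd_prime_gt2 po pp.
have : p %| m ^ 2 - 1.
  rewrite -(@Gauss_dvdr p 2) ?coprimen2 //.
  rewrite (_ : 2 * (m ^ 2 - 1) = p * repunit p (2 * a)) ?dvdn_mulr //.
  by rewrite mulnBr Em repunitSl; lia.
case/dvdnP => t Et; have {Et} Et : m ^ 2 = 1 + p * t.
  by rewrite mulnC -Et subnKC // expn_gt0 m0.
(* Thus [2 t = 1] modulo [p], which turns [M t = W] into [M = 2 W]. *)
have Et2 : 2 * t = 1 + p * repunit p (2 * a).-1.
  have : p * (2 * t) = p * repunit p (2 * a) by move: Em; rewrite Et repunitSl; lia.
  move/eqP; rewrite eqn_pmul2l ?prime_gt0 // => /eqP->.
  by rewrite -[in LHS](prednK (_ : 0 < 2 * a)) ?repunitSl //; lia.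
have {key} key : M = 2 * W %[mod p].
  move: key; rewrite Et expn_1D_mod => /eqP; rewrite eqn_modDl.
  rewrite expnS expn1 -!muln_modr eqn_pmul2l ?prime_gt0 // => key.
  have {}key : M * t = W %[mod p].
    apply/eqP; move: key; rewrite [M * L * t]mulnAC.
    by move/eqP/(modn_coprime_mul2r _ _ _ _ pL)/eqP.
  have E : 2 * (M * t) = M + p * (M * repunit p (2 * a).-1) by rewrite mulnCA Et2; lia.
  rewrite -[RHS]modnMmr -key modnMmr E addnC mulnC modnMDl //.
have Tn : T <> [::].
  move=> T0; move: key; rewrite /M /W /exponent_prod /exponent_sum T0 !big_nil muln0 mod0n.
  by rewrite modn_small ?prime_gt1.
have lt1 := exponent_prod_lt_sum p T n F Tn.
have lt2 := exponent_sum_lt p T n F.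
have : p %| 2 * W - M by rewrite -eqn_mod_dvd 1?eq_sym ?key // ltnW.
by move/dvdn_leq; lia.
Qed.

(** * Reduction to exponent one *)

(** Divisibility by 5 would give [3 * 9 ^ a = 1] modulo 5, although [9 ^ a] is 1 or -1 there. *)
Lemma repunit_3_mod5 a : repunit 3 (2 * a).+1 <> 0 %[mod 5].
Proof.
move=> E; have := repunit_pred 3 (2 * a).+1 isT.
have -> : 3 ^ (2 * a).+1 = 3 * 9 ^ a by rewrite expnS expnM.
suff : 9 ^ a %% 5 = 1 \/ 9 ^ a %% 5 = 4 by move: E; lia.
elim: a {E} => [|a IH]; first by left.
by rewrite expnS; lia.
Qed.

Lemma repunit_mod_pfactor p b c : b <= c -> repunit p c = repunit p b %[mod p ^ b].
Proof. by move=> bc; rewrite -(subnKC bc) repunitD addnC mulnC modnMDl. Qed.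

(* Here [p ^ b] is the exact power of [p] in [q + 1], [sigma (p ^ (2a)) = q u] and
   [sigma (m ^ 2) = c p ^ (2a - b)]. *)
Lemma euler_pair_unit p b u c : prime p -> odd p -> odd u -> odd c ->
  u * u * c * p.-1 < 2 * p ^ b.+1 -> p ^ b %| repunit p b + u ->
  (p = 3 -> b = 2 -> u <> 5) -> [/\ b = 0, u = 1 & c = 1].
Proof.
move=> pp po uo co lt dv ex; have p2 := odd_prime_gt2 po pp.
have u0 : 0 < u by case: u uo {lt dv ex}.
have c0 : 0 < c by case: c co {lt}.
case: b lt dv ex => [|b] lt dv ex.
  rewrite expn1 in lt; have u1 : u < 3.
    rewrite ltnNge; apply/negP => u3.
    have : 3 * 3 * 1 * p.-1 <= u * u * c * p.-1 by rewrite !leq_mul.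
    by move: lt p2; clear; lia.
  have Eu : u = 1 by case: u uo u1 {lt dv ex u0} => [|[|[|]]].
  rewrite Eu in lt *; have c1 : c < 3.
    rewrite ltnNge; apply/negP => c3.
    have : 3 * p.-1 <= c * p.-1 by rewrite leq_mul.
    by move: lt p2; clear; lia.
  by split=> //; case: c co c1 {lt c0} => [|[|[|]]].
exfalso.
(* A positive exponent makes [u] at least about [p ^ (b + 1) (p - 2) / (p - 1)]; against the upper
   bound on [u ^ 2] this leaves [p = 3] and exponent 1 or 2. *)
have le : p ^ b.+1 <= repunit p b.+1 + u by apply: dvdn_leq => //; lia.
have E := repunit_pred p b.+1 (prime_gt0 pp).
have H1 : p ^ b.+1 * p.-2 + 1 <= u * p.-1.
  move: E le; move: (repunit _ _) (p ^ b.+1) p2; clear => R P p2 E le; nia.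
have H2 : u * u * p.-1 < 2 * p ^ b.+2.
  by apply: leq_ltn_trans lt; rewrite leq_mul2r leq_pmulr // orbT.
have H3 : p ^ b * (p.-2 * p.-2) < 2 * p.-1.
  have P0 : 0 < p ^ b.+1 by rewrite expn_gt0 prime_gt0.
  have H4 : p ^ b.+1 * p.-2 * (p ^ b.+1 * p.-2) < u * p.-1 * (u * p.-1) by apply: ltn_mul; lia.
  have H5 : u * p.-1 * (u * p.-1) < 2 * p ^ b.+2 * p.-1.
    by rewrite (_ : _ * _ * _ = u * u * p.-1 * p.-1) ?ltn_pmul2r //; lia.
  have := ltn_trans H4 H5; rewrite !(expnS _ b.+1).
  have -> : p ^ b.+1 * p.-2 * (p ^ b.+1 * p.-2) = (p * p ^ b.+1) * (p ^ b * (p.-2 * p.-2)).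
    by rewrite expnS; lia.
  have -> : 2 * (p * p ^ b.+1) * p.-1 = (p * p ^ b.+1) * (2 * p.-1) by lia.
  by rewrite ltn_pmul2l // muln_gt0 P0 prime_gt0.
have b0 : 0 < p ^ b by rewrite expn_gt0 prime_gt0.
have p3 : p = 3.
  have p4 : p < 5.
    by rewrite ltnNge; apply/negP => p5; move: H3 p5 b0; clear; move: (p ^ b) => P; nia.
  by move: po p2 p4; clear; lia.
rewrite p3 in lt dv H3; have {}ex := ex p3.
have b2 : b < 2.
  rewrite ltnNge; apply/negP => b2; have : 3 ^ 2 <= 3 ^ b by rewrite leq_exp2l.
  by move: H3; lia.
have uu : u * u * 2 < 2 * 3 ^ b.+2.
  by apply: leq_ltn_trans lt; rewrite leq_mul2r leq_pmulr.
(* With [u] odd, [3] dividing [1 + u] contradicts [u < 3], and [9] dividing [4 + u] with [u < 6]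
   leaves only the excluded [u = 5]. *)
case: b b2 dv uu ex {lt H1 H2 H3 le E b0} => [|[|b]] // _.
  rewrite repunitS repunit0 expn0 => dv uu _.
  have u3 : u < 3 by move: uu; rewrite !expnS expn0; clear; nia.
  by move: dv uo; case: u u3 {u0 uu} => [|[|[|]]].
rewrite !repunitS repunit0 expn0 expn1 => dv uu.
have u6 : u < 6 by move: uu; rewrite !expnS expn0; clear; nia.
move=> ex; have := ex erefl.
by move: dv uo; case: u u6 {u0 uu ex} => [|[|[|[|[|[|]]]]]].
Qed.

Lemma special_prime_lt_of_exponent1 q n : prime q -> odd q -> odd n -> coprime q n ->
  q.+1 * sigma (n ^ 2) = 2 * (q * n ^ 2) -> q < n.
Proof.
move=> pq qo no cqn Eq; have n0 : 0 < n by case: n no {cqn Eq}.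
rewrite ltnNge; apply/negP => nq.
have {}nq : n < q.
  rewrite ltn_neqAle nq andbT; apply: contraTneq cqn => ->.
  by rewrite /coprime gcdnn; have := prime_gt1 pq; case: q {pq qo Eq nq} => [|[|]].
have : q %| sigma (n ^ 2).
  by rewrite -(@Gauss_dvdr q q.+1) ?coprimenS // Eq mulnCA dvdn_mulr.
rewrite sigma_sqr // Euclid_dvd_prod // big_has => /hasP[p].
rewrite mem_primes => /and3P[pp _ pn]; set a := logn p n => /dvdnP[u Eu].
have a0 : 0 < a by rewrite /a logn_gt0 mem_primes pp n0.
have po : odd p by apply: dvdn_odd pn no.
have p1 := prime_gt1 pp; have p0 := prime_gt0 pp.
have [m cpm En] := pfactor_coprime pp n0; rewrite -/a in En.
have m0 : 0 < m by move: n0; rewrite En muln_gt0 => /andP[].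
have mo : odd m by move: no; rewrite En oddM => /andP[].
have Es : sigma (n ^ 2) = sigma (m ^ 2) * (u * q).
  rewrite En expnMn -expnM mulnC [a * 2]mulnC sigmaM ?expn_gt0 ?p0 ?m0 //.
    by rewrite sigma_pfactor // Eu mulnC.
  by rewrite coprimeXl // coprimeXr.
have {}Eq : q.+1 * u * sigma (m ^ 2) = 2 * (p ^ (2 * a) * m ^ 2).
  apply/eqP; rewrite -(eqn_pmul2l (prime_gt0 pq)); apply/eqP.
  have -> : q * (q.+1 * u * sigma (m ^ 2)) = q.+1 * sigma (n ^ 2) by rewrite Es; lia.
  by rewrite Eq En expnMn -expnM [a * 2]mulnC; lia.
have pa0 : 0 < p ^ a by rewrite expn_gt0 p0.
have cpu : coprime p u.
  apply: coprime_dvdr (coprime_repunit p (2 * a).+1 isT).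
  by rewrite Eu dvdn_mulr.
have t0 : 0 < sigma (m ^ 2).
  have : 0 < q.+1 * u * sigma (m ^ 2) by rewrite Eq !muln_gt0 !expn_gt0 p0 m0.
  by rewrite muln_gt0 => /andP[].
have u0 : 0 < u by case: (u) cpu => //; rewrite /coprime gcdn0 => /eqP; lia.
have [w cpw] := pfactor_coprime pp (isT : 0 < q.+1); set b := logn p _ => Ew.
have [c cpc] := pfactor_coprime pp t0; set g := logn p _ => Ec.
have w0 : 0 < w by case: (w) Ew.
have c0 : 0 < c by case: (c) Ec t0 => // ->.
have Ebg : b + g = 2 * a.
  have /(congr1 (logn p)) : w * u * c * p ^ (b + g) = 2 * m ^ 2 * p ^ (2 * a).
    by rewrite expnD; move: Eq; rewrite {1}Ew {1}Ec; lia.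
  have cp2 : coprime p (2 * m ^ 2) by rewrite coprimeMr coprimen2 po coprimeXr.
  have cpx : coprime p (w * u * c) by rewrite !coprimeMr cpw cpu cpc.
  rewrite !(@lognM p _ (p ^ _)) ?pfactorK ?muln_gt0 ?expn_gt0 ?p0 ?m0 ?w0 ?u0 ?c0 //.
  by rewrite !logn_coprime.
have Em : w * u * c = 2 * m ^ 2.
  apply/eqP; rewrite -(eqn_pmul2r (_ : 0 < p ^ (2 * a))) ?expn_gt0 ?p0 //; apply/eqP.
  by rewrite -{1}Ebg expnD; move: Eq; rewrite {1}Ew {1}Ec; lia.
have we : ~~ odd w.
  have : ~~ odd q.+1 by rewrite /= qo.
  by rewrite Ew oddM oddX po orbT andbT.
have Ew2 : w = 2 * w./2 by lia.
have uco : odd u && odd c.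
  have : odd (w./2 * u * c).
    by rewrite (_ : w./2 * u * c = m ^ 2) ?oddX ?mo ?orbT //; lia.
  by rewrite !oddM => /andP[/andP[_ ->] ->].
have [uo co] := andP uco.
(* [H1] uses [n < q] through [q u = sigma (p ^ (2a))], and [H2] through [q + 1 = w p ^ b];
   multiplying them cancels [m] and [p ^ a]. *)
have H1 : m * u * p.-1 < p ^ a.+1.
  rewrite -(ltn_pmul2l pa0) -expnD.
  have -> : a + a.+1 = (2 * a).+1 by lia.
  rewrite -(repunit_pred p (2 * a).+1 p0) Eu addn1 ltnS.
  apply: (@leq_trans (q * (u * p.-1))); last by lia.
  have -> : p ^ a * (m * u * p.-1) = n * (u * p.-1) by rewrite En; lia.
  by rewrite leq_mul2r ltnW // orbT.
have H2 : p ^ a * (u * c) < 2 * m * p ^ b.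
  rewrite -(ltn_pmul2l m0).
  have -> : m * (2 * m * p ^ b) = q.+1 * (u * c).
    by rewrite Ew; have := congr1 (muln (p ^ b)) Em; rewrite expnS expn1; lia.
  have -> : m * (p ^ a * (u * c)) = n * (u * c) by rewrite En; lia.
  by rewrite ltn_pmul2r ?muln_gt0 ?u0 // ltnS ltnW.
have H3 : u * u * c * p.-1 < 2 * p ^ b.+1.
  have mp0 : 0 < m * p ^ a by rewrite muln_gt0 m0.
  rewrite -(ltn_pmul2l mp0).
  have -> : m * p ^ a * (u * u * c * p.-1) = (m * u * p.-1) * (p ^ a * (u * c)) by lia.
  have -> : m * p ^ a * (2 * p ^ b.+1) = p ^ a.+1 * (2 * m * p ^ b).
    by rewrite !(expnS p); lia.
  exact: ltn_mul.
(* Modulo [p ^ b], [repunit p b] is [u q], and [u q + u = u (q + 1)] vanishes. *)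
have dv : p ^ b %| repunit p b + u.
  rewrite /dvdn -modnDml -(repunit_mod_pfactor p b (2 * a).+1) ?modnDml; last by lia.
  rewrite Eu (_ : u * q + u = u * w * p ^ b) ?modnMl //.
  by rewrite -mulnA -Ew mulnS addnC.
have ex : p = 3 -> b = 2 -> u <> 5.
  move=> p3 _ u5; move: Eu; rewrite p3 u5 => E.
  by apply: (repunit_3_mod5 a); rewrite E modnMr mod0n.
have [b0 u1 c1] := euler_pair_unit p b u c pp po uo co H3 dv ex.
move: Ew Ec Em Eu Ebg; rewrite b0 u1 c1 expn0 !muln1 mul1n add0n => Ew Ec Em Eu Eg.
apply: (no_euler_pair p a m) => //; first by rewrite Ec Eg.
by rewrite -Em -Ew Eu mul1n.

Qed.

Theorem theorem1 (N q k n : nat) (hodd : odd N) (hperf : perfect N)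
  (heul : eulerian_form N q k n) : q < n.
Proof.
have [EN pq [k0 n0] [q4 k4] /eqP cqn] := heul.
have [_ Es] := hperf.
have q0 := prime_gt0 pq; have q1 := prime_gt1 pq.
have {Es} Es : repunit q k.+1 * sigma (n ^ 2) = 2 * (q ^ k * n ^ 2).
  rewrite -EN -Es EN sigmaM ?expn_gt0 ?q0 ?n0 //; last by rewrite coprimeXl // coprimeXr.
  by rewrite (sigma_pfactor q).
have /andP[qo no] : odd q && odd n.
  by move: hodd; rewrite EN oddM !oddX /= [k == 0]gtn_eqF.
have [k1|k5] : k = 1 \/ 5 <= k by move: k0 k4; clear; lia.
  apply: special_prime_lt_of_exponent1 => //.
  by move: Es; rewrite k1 !repunitS repunit0 expn0 expn1.
have q5 : 5 <= q.
  by move: q1 q4 qo; clear; lia.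
have s0 : 0 < sigma (n ^ 2).
  have : 0 < repunit q k.+1 * sigma (n ^ 2) by rewrite Es !muln_gt0 !expn_gt0 q0 n0.
  by rewrite muln_gt0 => /andP[].
have dv : q ^ k %| sigma (n ^ 2).
  rewrite -(@Gauss_dvdr _ (repunit q k.+1)) ?coprimeXl ?coprime_repunit //.
  by rewrite Es mulnCA dvdn_mulr.
have lt : sigma (n ^ 2) < 2 * n ^ 2.
  rewrite -(@ltn_pmul2l (q ^ k)) ?expn_gt0 ?q0 //.
  rewrite [q ^ k * (2 * _)]mulnCA -Es ltn_pmul2r //.
  exact: (expn_ltn_repunit q k.+1 q1).
have H := leq_ltn_trans (dvdn_leq s0 dv) lt.
have : q ^ 5 < 2 * n ^ 2 by apply: leq_ltn_trans H; rewrite leq_exp2l.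
rewrite (expnD q 3 2) => lt5.
have : 2 * q ^ 2 < 2 * n ^ 2.
  apply: leq_ltn_trans lt5; rewrite leq_mul2r; apply/orP; right.
  by apply: (@leq_trans (q ^ 1)); rewrite ?expn1 ?leq_pexp2l //; lia.
by rewrite ltn_pmul2l // ltn_exp2r.
Qed.
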